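(* Let $a,b,n$ be positive integers with $a\leq b$ and $n\geq av^2+b$, where $v=a+b$. Suppose that $b(b-1)\not\equiv 0 \pmod a$, and let $\Delta:[1,n]\to\{0,1\}$ be a $2$-coloring of $[1,n]$ with $\Delta(1)=0$ and $\Delta(a)=\Delta(b)=\delta$ for some $\delta\in\{0,1\}$. Then there is a monochromatic solution to the equation $ax+by=z$ with $x,y,z\in[1,n]$, i.e. there exist $x,y,z\in[1,n]$ with $ax+by=z$ and $\Delta(x)=\Delta(y)=\Delta(z)$.
   Context: $[1,n]=\{1,2,\ldots,n\}$. A $2$-coloring of $[1,n]$ is a function $\Delta:[1,n]\to\{0,1\}$. The numbers $x,y,z$ in a solution need not be distinct. *)

(* Defs.v *)
From mathcomp Require Export all_boot.
Set Implicit Arguments.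
Unset Strict Implicit.
Unset Printing Implicit Defensive.

(* A 2-coloring of [1, n] is given by a total function [Delta : nat -> 'I_2];
   only its values on [1, n] are constrained or used. *)
Definition mono_solution (a b n : nat) (Delta : nat -> 'I_2) : Prop :=
  exists x y z : nat,
    [/\ 1 <= x <= n, 1 <= y <= n & 1 <= z <= n] /\
    [/\ a * x + b * y = z, Delta x = Delta y & Delta y = Delta z].

(* Main.v *)
Require Import Defs.
From mathcomp Require Import all_boot.
From mathcomp Require Import zify.

(* Assume there is no monochromatic solution and put v = a + b. The engine is an
   exchange argument: if aX + bY = ax + by, where x and y have color k and Y has
   the other color, then X has color k.

   Suppose a and b have the color opposite to 1. Exchange shows that the color of
   1 is preserved by +a and by +b below ab + a, while ab + a + b, being
   a * 1 + b * (1 + a), has the opposite color. Since gcd(a, b) and gcd(a, b) * v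
   can both be completed to ab + a + b by adding copies of a and b, neither has the
   color of 1; but gcd(a, b) * v is the sum for x = y = gcd(a, b). Here a must not
   divide b.

   Suppose a and b have the color of 1. Exchange along the ray a^2 + bt shows that
   all of [1, v - 1] has the color of 1. Writing a = pg and b = qg with g = gcd(a, b),
   this in turn gives the opposite color to a^2 + qw for all w >= g in range. Choosing w
   with qw = 1 mod p yields a^2 + qw = 1 + pM, and X = v^2 - qM is again of the form
   a^2 + qw'; then aX + b(1 + pM) = av^2 + b, whose color is also opposite to that
   of 1 because v^2 has the color of 1. *)

(** With two colors, avoiding the common color of [x] and [y] means taking its negation, so this is
    the absence of monochromatic solutions as an equation. *)
Definition sum_flips (a b n : nat) (c : nat -> bool) : Prop :=
  forall x y, 0 < x -> 0 < y -> a * x + b * y <= n ->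
    c x = c y -> c (a * x + b * y) = ~~ c x.

Lemma neq_negb (x k : bool) : x <> k -> x = ~~ k.
Proof. by case: x k => [] []. Qed.

(** If [X] had color [~~ k], the pair [X], [Y] would force color [k] on the common sum, while [x],
    [y] force [~~ k]. *)
Lemma exchange_l a b n c x y X Y (k : bool) : sum_flips a b n c ->
  a * X + b * Y = a * x + b * y -> a * x + b * y <= n ->
  0 < x -> 0 < y -> 0 < X -> 0 < Y ->
  c x = k -> c y = k -> c Y = ~~ k -> c X = k.
Proof.
move=> cP eqT leT x0 y0 X0 Y0 cx cy cY.
have := cP x y x0 y0 leT; rewrite cx cy => /(_ erefl) cT.
have := cP X Y X0 Y0; rewrite eqT cY cT => /(_ leT).
by case: (c X) k {cx cy cY cT} => [] [] // /(_ erefl).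
Qed.

Lemma sum_flipsC a b n c : sum_flips a b n c -> sum_flips b a n c.
Proof.
move=> cP x y x0 y0; rewrite addnC => leT cxy.
by rewrite (cP y x y0 x0 leT) ?cxy.
Qed.

(** * Congruences and representations with coprime coefficients *)

Lemma congruence_window p q s N : 0 < p -> coprime p q ->
  exists2 w, s <= w < s + p & q * w = N %[mod p].
Proof.
move=> p0 cop.
have [u uq] : exists u, q * u = 1 %[mod p].
  have [q0 | q0] := posnP q.
    by exists 0; move: cop; rewrite q0 /coprime gcdn0 => /eqP ->; rewrite !modn1.
  have [/= u w e _] := egcdnP p q0; exists u.
  by rewrite mulnC e gcdnC (eqP cop) modnMDl.
(* [p.-1 * s] plays [-s] modulo [p], so the witness is congruent to [N * u]. *)
exists (s + (N * u + p.-1 * s) %% p).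
  by rewrite leq_addr ltn_add2l ltn_pmod.
rewrite -modnMmr modnDmr modnMmr.
have -> : q * (s + (N * u + p.-1 * s)) = q * s * p + N * (q * u) by nia.
by rewrite modnMDl -modnMmr uq modnMmr muln1.
Qed.

(** Choose [j < p] with [q * j] congruent to [N]. If [q * j > N], the difference is at least [p], so
    [N <= q * p.-1 - p], just below the Sylvester bound. *)
Lemma coprime_representable p q N : 0 < p -> coprime p q ->
  p.-1 * q.-1 <= N -> exists i j, p * i + q * j = N.
Proof.
move=> p0 cop leN; have [j] := congruence_window p q 0 N p0 cop.
rewrite add0n => /andP[_ ltj] eqj.
have [le | lt] := leqP (q * j) N.
  have /dvdnP[i ei] : p %| N - q * j by rewrite -eqn_mod_dvd // eqj.
  by exists i, j; lia.
have dvd : p %| q * j - N by rewrite -eqn_mod_dvd ?eqj // ltnW.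
have leD : p <= q * j - N by apply: dvdn_leq dvd; rewrite subn_gt0.
have q0 : 0 < q by case: q lt {cop leN eqj dvd leD}.
have : q * j <= q * p.-1 by rewrite leq_mul2l; lia.
nia.
Qed.

(* If [x + a] had the other color, that color would be stable under [+ b],
   hence would propagate from [e] to [e + b * m]. *)
Lemma color_shift a b n c k x e m : sum_flips a b n c -> 0 < x -> 0 < e ->
  a * (e + b * m) + b * x <= n ->
  c e = ~~ k -> c (e + b * m) = k -> c x = k -> c (x + a) = k.
Proof.
move=> cP x0 e0 leT ce cem cx.
apply/eqP; apply: contraT => /eqP/neq_negb cxa.
have stable i : i <= m -> c (e + b * i) = ~~ k.
  elim: i => [|i IHi] lei; first by rewrite muln0 addn0.
  apply: (exchange_l a b n c (e + b * i) (x + a) (e + b * i.+1) x);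
    rewrite ?negbK //; [lia | | lia | lia | lia | by apply: IHi; lia].
  have : a * (b * i.+1) <= a * (b * m) by rewrite !leq_mul.
  lia.
by move: (stable m (leqnn m)); rewrite cem; case: (k).
Qed.

Lemma gcdn_cofactors a b : 0 < a ->
  exists p q, [/\ 0 < p, coprime p q, a = p * gcdn a b & b = q * gcdn a b].
Proof.
move=> a0; have g0 : 0 < gcdn a b by rewrite gcdn_gt0 a0.
exists (a %/ gcdn a b), (b %/ gcdn a b).
rewrite !divnK ?dvdn_gcdl ?dvdn_gcdr //; split => //.
  by rewrite divn_gt0 // dvdn_leq // dvdn_gcdl.
rewrite /coprime -(eqn_pmul2r g0) muln_gcdl.
by rewrite !divnK ?dvdn_gcdl ?dvdn_gcdr // mul1n.
Qed.

Lemma gcdn_representable a b : 0 < a -> 0 < b ->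
  exists i j, gcdn a b + a * i + b * j = a * b + a.
Proof.
move=> a0 b0; have g0 : 0 < gcdn a b by rewrite gcdn_gt0 a0.
have [p [q [p0 cop ea eb]]] := gcdn_cofactors a b a0.
move: (gcdn a b) g0 ea eb => g g0 -> eb; rewrite eb in b0 *.
have q0 : 0 < q by move: b0; rewrite muln_gt0 => /andP[].
have le : p.-1 * q.-1 <= g * p * q + p - 1.
  have : p.-1 * q.-1 <= p * q by rewrite leq_mul ?leq_pred.
  by have : p * q <= g * (p * q) := leq_pmull _ g0; lia.
have [i [j eij]] := coprime_representable p q _ p0 cop le.
by exists i, j; nia.
Qed.

(** Non-divisibility makes both cofactors at least 2, so [p + q <= p * q]; what remains after
    division by the gcd then meets the Sylvester bound. *)
Lemma gcdn_mul_add_representable a b : 0 < a -> 0 < b ->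
  ~~ (a %| b) -> ~~ (b %| a) ->
  exists i j, gcdn a b * (a + b) + a * i + b * j = a * b + a.
Proof.
move=> a0 b0 ndvab ndvba; have g0 : 0 < gcdn a b by rewrite gcdn_gt0 a0.
have [p [q [p0 cop ea eb]]] := gcdn_cofactors a b a0.
have p1 : p != 1.
  by apply: contra ndvab => /eqP p1; rewrite ea p1 mul1n dvdn_gcdr.
have q1 : q != 1.
  by apply: contra ndvba => /eqP q1; rewrite eb q1 mul1n dvdn_gcdl.
move: (gcdn a b) g0 ea eb => g g0 -> eb; rewrite eb in b0 *.
have q0 : 0 < q by move: b0; rewrite muln_gt0 => /andP[].
have pq : p + q <= p * q by clear -p0 p1 q0 q1; nia.
have gpq : g * (p + q) <= g * (p * q) by rewrite leq_mul.
have le : p.-1 * q.-1 <= g * (p * q) + p - g * (p + q).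
  have : g.-1 * (p + q) <= g.-1 * (p * q) by rewrite leq_mul.
  by clear -g0 p0 q0 gpq; nia.
have [i [j eij]] := coprime_representable p q _ p0 cop le.
exists i, j; have : p * i + q * j + g * (p + q) = g * (p * q) + p.
  by rewrite eij subnK //; lia.
by clear; nia.
Qed.

(** * Case where [a] and [b] have the color opposite to 1 *)

Lemma a_b_opposite_one a b n c k : sum_flips a b n c ->
  0 < a -> 0 < b -> a * (a + b) ^ 2 + b <= n -> ~~ (a %| b) -> ~~ (b %| a) ->
  c 1 = k -> c a = ~~ k -> c b = ~~ k -> False.
Proof.
move=> cP a0 b0 len ndvab ndvba c1 ca cb.
(* The progressions from [b] to [2 * a * b] and from [a] to [a * (a + b)] change color between their
   ends, as [color_shift] requires. *)
have c2ab : c (b + b * (2 * a).-1) = k.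
  have -> : b + b * (2 * a).-1 = a * b + b * a by nia.
  by rewrite cP ?ca ?cb ?negbK //; nia.
have cav : c (a + a * (a + b).-1) = k.
  have -> : a + a * (a + b).-1 = a * a + b * a by nia.
  by rewrite cP ?ca ?negbK //; nia.
have shift_a x : 0 < x <= a * b -> c x = k -> c (x + a) = k.
  move=> /andP[x0 lex] cx.
  apply: (color_shift a b n c k x b (2 * a).-1) => //.
  have : b * x <= b * (a * b) by rewrite leq_mul.
  have -> : b + b * (2 * a).-1 = 2 * a * b by nia.
  nia.
have shift_b x : 0 < x <= a * (a + b) -> c x = k -> c (x + b) = k.
  move=> /andP[x0 lex] cx.
  apply: (color_shift b a n c k x a (a + b).-1) => //.
    exact: sum_flipsC.
  have : a * x <= a * (a * (a + b)) by rewrite leq_mul.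
  have -> : a + a * (a + b).-1 = a * (a + b) by nia.
  nia.
have ce : c (a * b + a + b) = ~~ k.
  have c1a : c (1 + a) = k by apply: shift_a => //; nia.
  have -> : a * b + a + b = a * 1 + b * (1 + a) by lia.
  by rewrite cP ?c1 ?c1a //; nia.
(* The steps [+ a] come first and start at most at [a * b]; the steps [+ b] may start as high as
   [a * (a + b)], so one more leads from [a * b + a] to [a * b + a + b]. *)
have unreachable x i j : 0 < x -> c x = k -> x + a * i + b * j <> a * b + a.
  move=> x0 cx exij.
  have ci i' : i' <= i -> c (x + a * i') = k.
    elim: i' => [|i' IHi] lei; first by rewrite muln0 addn0.
    rewrite mulnSr addnA; apply: shift_a; last by apply: IHi; lia.
    have : a * i'.+1 <= a * i by rewrite leq_mul.
    clear -x0 exij; lia.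
  have cj j' : j' <= j -> c (x + a * i + b * j') = k.
    elim: j' => [|j' IHj] lej; first by rewrite muln0 addn0 ci.
    rewrite mulnSr addnA; apply: shift_b; last by apply: IHj; lia.
    have : b * j'.+1 <= b * j by rewrite leq_mul.
    clear -x0 exij a0; nia.
  have : c (a * b + a + b) = k.
    by rewrite -exij; apply: shift_b; rewrite ?cj //; nia.
  by rewrite ce; case: (k).
have g0 : 0 < gcdn a b by rewrite gcdn_gt0 a0.
have cg : c (gcdn a b) = ~~ k.
  apply: neq_negb => cg; have [i [j eij]] := gcdn_representable a b a0 b0.
  exact: (unreachable _ i j g0 cg eij).
have cgv : c (gcdn a b * (a + b)) = k.
  rewrite mulnDr ![gcdn a b * _]mulnC cP ?cg ?negbK //.
  have : gcdn a b <= a by apply: dvdn_leq => //; apply: dvdn_gcdl.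
  clear -a0 b0 len; nia.
have [i [j eij]] := gcdn_mul_add_representable a b a0 b0 ndvab ndvba.
by apply: (unreachable _ i j _ cgv eij); rewrite muln_gt0 g0 addn_gt0 a0.
Qed.

(** * Case where [a] and [b] have the color of 1 *)

Lemma color_shift_pair a b n c k x r s : sum_flips a b n c ->
  0 < x -> 0 < r -> a * (x + b * s) + b * r <= n ->
  c x = k -> c (r + a * s) = k -> c r = ~~ k -> c (x + b * s) = k.
Proof.
move=> cP x0 r0 le cx crs cr.
by apply: (exchange_l a b n c x (r + a * s) (x + b * s) r k) => //; lia.
Qed.

(** A bootstrap: a first stretch of the ray, with room [b * b], colors only [[1, a]]; this shrinks
    the room to [b * a], which suffices for all of [[1, a + b - 1]]. *)
Lemma small_color a b n c k : sum_flips a b n c ->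
  1 < a -> a <= b -> a * (a + b) ^ 2 + b <= n ->
  c 1 = k -> c a = k -> c b = k ->
  (forall t, 0 < t -> a * (a * a + b * t) + b * a <= n ->
     c (a * a + b * t) = ~~ k) /\
  (forall x, 0 < x < a + b -> c x = k).
Proof.
move=> cP a1 leab len c1 ca cb.
have a0 : 0 < a by apply: ltnW.
have b0 : 0 < b by apply: leq_trans leab.
have cv : c (b + a * 1) = ~~ k.
  have -> : b + a * 1 = a * 1 + b * 1 by lia.
  by rewrite cP ?c1 //; clear -a0 b0 len; nia.
have caab : c (a * a + b * 1) = ~~ k.
  by rewrite cP ?ca ?c1 //; clear -a0 b0 len; nia.
have ray t : 0 < t -> a * (a * a + b * t) + b * b <= n ->
    c (a * a + b * t) = ~~ k.
  elim: t => [//|[//|t] IHt] _ le.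
  have -> : a * a + b * t.+2 = a * a + b * t.+1 + b * 1 by lia.
  apply: (color_shift_pair a b n c (~~ k) _ b 1) => //; rewrite ?negbK //.
  - by clear -a0; nia.
  - by clear -le; lia.
  - by apply: IHt => //; clear -le; lia.
have of_ray x : 0 < x -> a * a + b * (a + x) <= n ->
    c (a * a + b * (a + x)) = ~~ k -> c x = k.
  move=> x0 le cz; apply/eqP; apply: contraT => /eqP/neq_negb cx.
  have v0 : 0 < b + a * 1 by clear -b0; lia.
  have e : a * (b + a * 1) + b * x = a * a + b * (a + x) by clear; lia.
  by have := cP _ _ v0 x0; rewrite e cv cx cz => /(_ le erefl); case: (k).
have le_a x : 0 < x <= a -> c x = k.
  move=> /andP[x0 lex]; apply: of_ray => //.
    have : b * x <= b * a by rewrite leq_mul.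
    by clear -a0 len; nia.
  apply: ray; first by clear -a0; lia.
  have : a * (b * x) <= a * (b * a) by rewrite !leq_mul.
  by clear -a1 len; nia.
(* Dividing [b.-1] puts the residue [r.+1] in [[1, a]], already colored [k]. It replaces [b] as the
   lower end of a pair ending at [a + b], giving ray steps of [b * q.+1]. *)
have b_eq : b = (b.-1 %% a).+1 + a * (b.-1 %/ a).
  by have := divn_eq b.-1 a; clear -b0; lia.
have r_le : b.-1 %% a < a by rewrite ltn_pmod.
move: (b.-1 %% a) (b.-1 %/ a) b_eq r_le => r q b_eq r_le.
have cr : c r.+1 = k by apply: le_a; rewrite r_le.
have ray' t : 0 < t -> a * (a * a + b * t) + b * a <= n ->
    c (a * a + b * t) = ~~ k.
  move=> t0 le; have [let_ | ltt] := leqP t q.+1.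
    apply: ray => //.
    have : a * (b * t) <= a * (b * q.+1) by rewrite !leq_mul.
    have : b * (r.+1 + a * q) = b * b by rewrite -b_eq.
    by clear -a1 len; nia.
  have -> : a * a + b * t = a * a + b * (t - q.+1) + b * q.+1.
    by rewrite -addnA -mulnDr subnK // ltnW.
  apply: (color_shift_pair a b n c (~~ k) _ r.+1 q.+1) => //; rewrite ?negbK //.
  - by clear -a0; nia.
  - rewrite -addnA -mulnDr subnK ?(ltnW ltt) //.
    by apply: leq_trans le; rewrite leq_add2l leq_mul.
  - apply: ray; first by rewrite subn_gt0.
    have : b * (r.+1 + a * q) = b * b by rewrite -b_eq.
    have : b * r.+1 <= b * a by rewrite leq_mul.
    have : b * (t - q.+1) + b * q.+1 = b * t by rewrite -mulnDr subnK // ltnW.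
    move: (t - q.+1) => t'; rewrite !mulnDr => e ler eb.
    have : a * (b * t' + b * q.+1) = a * (b * t) by rewrite e.
    by clear e; move: le; rewrite !mulnDr; clear -ler eb; lia.
  - have -> : r.+1 + a * q.+1 = b + a * 1 by rewrite [in RHS]b_eq; lia.
    by [].
split=> // x /andP[x0 ltx]; apply: of_ray => //.
  have : b * x <= b * (a + b) by rewrite leq_mul // ltnW.
  by clear -a0 len; nia.
apply: ray'; first by clear -a0; lia.
have : a * (b * x) <= a * (b * (a + b).-1) by rewrite !leq_mul; lia.
by clear -a0 len; nia.
Qed.

Lemma a_b_like_one a b n c k : sum_flips a b n c ->
  1 < a -> a <= b -> a * (a + b) ^ 2 + b <= n ->
  c 1 = k -> c a = k -> c b = k -> False.
Proof.
move=> cP a1 leab len c1 ca cb.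
have [ray small] := small_color a b n c k cP a1 leab len c1 ca cb.
have a0 : 0 < a by apply: ltnW.
have b0 : 0 < b by apply: leq_trans leab.
have cv : c (a + b) = ~~ k.
  have -> : a + b = a * 1 + b * 1 by lia.
  by rewrite cP ?c1 //; clear -a0 b0 len; nia.
have g0 : 0 < gcdn a b by rewrite gcdn_gt0 a0.
have [p [q [p0 cop ea eb]]] := gcdn_cofactors a b a0.
move: (gcdn a b) g0 ea eb => g g0 ea eb.
have q0 : 0 < q by move: b0; rewrite eb muln_gt0 => /andP[].
(* With [w = t * g + m], exchange from the ray point [a * a + b * t]: adding [q * m] to it is offset
   by taking [p * m] from [a + b], which lands in [[1, a + b - 1]]. *)
have cw w : g <= w -> a * (a * a + q * w) + b * (a + b) <= n ->
    c (a * a + q * w) = ~~ k.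
  move=> lew le.
  have t0 : 0 < w %/ g by rewrite divn_gt0.
  have m_lt : w %% g < g by rewrite ltn_pmod.
  have w_eq : q * w = b * (w %/ g) + q * (w %% g).
    by rewrite {1}(divn_eq w g) mulnDr eb -mulnA [g * _]mulnC.
  move: (w %/ g) (w %% g) t0 m_lt w_eq => t m t0 m_lt w_eq {lew}.
  have pm_lt : p * m < a by rewrite ea ltn_pmul2l.
  have eq_ab : a * (q * m) = b * (p * m) by rewrite ea eb; clear; lia.
  rewrite w_eq !mulnDr in le *; rewrite addnA.
  have ct : c (a * a + b * t) = ~~ k by apply: ray => //; clear -le; lia.
  have [->|m0] := posnP m; first by rewrite muln0 addn0.
  have pm0 : 0 < p * m by rewrite muln_gt0 p0.
  apply: (exchange_l a b n c (a * a + b * t) (a + b) _ (a + b - p * m)) => //.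
  - have : b * (a + b - p * m) + b * (p * m) = b * (a + b).
      by rewrite -mulnDr subnK // ltnW // ltn_addr.
    by clear -eq_ab; lia.
  - by clear -le; lia.
  - by clear -a0; nia.
  - by clear -a0; lia.
  - by clear -a0; nia.
  - by clear -pm_lt; lia.
  - by rewrite negbK; apply: small; clear -pm0 pm_lt; lia.
(* The window starts at [g] so that [cw] applies, and its length [p] keeps [q * w <= a * b]. *)
have [w /andP[gew ltw] /eqP] := congruence_window p q g 1 p0 cop.
have qw1 : 0 < q * w by rewrite muln_gt0 q0 (leq_trans g0).
rewrite eqn_mod_dvd // => /dvdnP[M0 eM0].
have [M eY] : exists M, a * a + q * w = 1 + p * M.
  exists (M0 + g * a); have -> : q * w = M0 * p + 1 by rewrite -eM0 subnK.
  by rewrite {1}ea; clear; lia.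
have qg_le : b <= q * w by rewrite eb leq_mul.
have qw_le : q * w <= a * b.
  have : q * w <= q * (p * g).
    rewrite leq_mul //; clear -ltw g0 p0; nia.
  move=> le; apply: (leq_trans le); rewrite -ea mulnC leq_mul //.
  by rewrite eb leq_pmulr.
have ab_pq : b * p = a * q by rewrite ea eb; clear; lia.
(* As [(a + b) ^ 2 - a * a = q * (g * (2 * a + b))], the second exponent-free parameter is
   [g * (2 * a + b) - M]; the bound makes it at least [g]. *)
have leM : M + g <= g * (2 * a + b).
  rewrite -(leq_pmul2l p0) !mulnDr [p * (g * _)]mulnA [p * (g * b)]mulnA -ea.
  by have := leq_pmulr a a0; clear -eY qw_le; lia.
have eX : a * a + q * (g * (2 * a + b) - M) + q * M = (a + b) ^ 2.
  rewrite -addnA -mulnDr subnK ?(leq_trans (leq_addr g M)) //.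
  by rewrite mulnA -eb; clear; lia.
have cY : c (a * a + q * w) = ~~ k.
  apply: cw => //.
  have : a * (q * w) <= a * (a * b) by rewrite leq_mul.
  by clear -len a1; nia.
have abqM : a * (q * M) + b = b * (a * a + q * w).
  by rewrite eY mulnA -ab_pq; clear; lia.
have cX : c (a * a + q * (g * (2 * a + b) - M)) = ~~ k.
  apply: cw; first by rewrite leq_subRL ?(leq_trans (leq_addr g M)).
  move: (a * a + _) eX => X eX; apply: leq_trans len; rewrite -eX.
  have : b * (a + b) <= b * (a * a + q * w).
    by rewrite leq_mul // leq_add // leq_pmull.
  by rewrite -abqM; clear; lia.
have : 0 < a * a + q * (g * (2 * a + b) - M) by rewrite addn_gt0 muln_gt0 a0.
move: (a * a + _) eX cX cY => X eX cX; rewrite eY => cY X0.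
have eT : a * X + b * (1 + p * M) = a * (a + b) ^ 2 + b * 1.
  by rewrite -eX mulnDr [in RHS]mulnDr [a * (q * M)]mulnA -ab_pq; clear; lia.
have cv2 : c ((a + b) ^ 2) = k.
  have -> : (a + b) ^ 2 = a * (a + b) + b * (a + b) by clear; lia.
  by rewrite cP ?cv ?negbK //; clear -a0 b0 len; nia.
have cT : c (a * (a + b) ^ 2 + b * 1) = ~~ k.
  by rewrite cP ?cv2 ?c1 // ?muln1 // expn_gt0 addn_gt0 a0.
have := cP X (1 + p * M) X0; rewrite cX cY eT cT => /(_ isT).
by rewrite muln1 => /(_ len erefl); case: (k).
Qed.

Theorem theorem1p2 (a b n : nat) (ha : 0 < a) (hb : 0 < b) (hn : 0 < n)
    (hab : a <= b) (hnv : a * (a + b) ^ 2 + b <= n)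
    (hmod : b * (b - 1) <> 0 %[mod a])
    (Delta : nat -> 'I_2) (delta : 'I_2)
    (h1 : Delta 1 = ord0) (hDa : Delta a = delta) (hDb : Delta b = delta) :
  mono_solution a b n Delta.
Proof.
(* The congruence hypothesis enters here; with [a <= b] it also excludes [b %| a] and [a = 1]. *)
have ndvab : ~~ (a %| b).
  apply/negP => dvab; apply: hmod.
  by apply/eqP; rewrite mod0n; apply: dvdn_mulr.
have ndvba : ~~ (b %| a).
  apply: contra ndvab => dvba; have leba := dvdn_leq ha dvba.
  have -> : a = b by apply/eqP; rewrite eqn_leq hab.
  exact: dvdnn.
have a1 : 1 < a.
  by case: a ha ndvab {hab hnv hmod hDa ndvba} => [|[|]] //; rewrite dvd1n.
(* Bounded quantifiers make the existence of a solution decidable. *)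
pose sol := [exists x : 'I_n.+1, exists y : 'I_n.+1,
  [&& 0 < x, 0 < y, a * x + b * y <= n, Delta x == Delta y
    & Delta y == Delta (a * x + b * y)]].
have [/existsP[x /existsP[y /and5P[x0 y0 le /eqP exy /eqP eyz]]] | nsol] :=
    boolP sol.
  exists x, y, (a * x + b * y).
  by rewrite x0 y0 le addn_gt0 muln_gt0 ha x0 -[x <= n]ltnS -[y <= n]ltnS !ltn_ord.
pose c x := Delta x == ord0.
have cE x y : c x = c y -> Delta x = Delta y.
  rewrite /c; case: (Delta x) (Delta y) => [[|[|//]] ?] [[|[|//]] ?] // _;
  exact: val_inj.
have cP : sum_flips a b n c.
  move=> x y x0 y0 le exy; apply: neq_negb => ezx.
  have lex : x < n.+1 by clear -le ha; nia.
  have ley : y < n.+1 by clear -le hb; nia.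
  case/negP: nsol; apply/existsP; exists (Ordinal lex).
  apply/existsP; exists (Ordinal ley); apply/and5P; split=> //; apply/eqP.
    exact: cE.
  by apply: cE; rewrite ezx.
have c1 : c 1 = true by rewrite /c h1.
have cab : c a = c b by rewrite /c hDa hDb.
exfalso; case ca: (c a).
  by apply: (a_b_like_one a b n c true cP) => //; rewrite -cab.
by apply: (a_b_opposite_one a b n c true cP) => //; rewrite -cab.
Qed.
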